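(* Let $D\in\mathbb{N}$ (with $0\in\mathbb{N}$) and let $G$ be an outerplanar graph that contains a graph from $A_D\cup B_D$ as a minor. Then $G$ has diameter at least $D+1$.
   Context: For a family $X$ of graphs and a positive integer $i$, $iX$ denotes the family of all disjoint unions of $i$ graphs from $X$ (not necessarily the same member), and $\operatorname{join}(v,iX)$ denotes the family of graphs obtained by taking $i$ graphs from $X$ together with a new vertex $v$ and connecting each of the $i$ graphs to $v$ by a single edge. $K_1$ is the one-vertex graph and $2K_1$ is the graph on two isolated vertices; $K_{1,3}$ is the star with three leaves. The families $A_i$ ($i\ge0$) and $B_i$ ($i\ge1$) are defined recursively by: $A_0=\{2K_1\}$; for $i\ge1$, $A_i=2B_{i-1}$ if $i$ is even and $A_i=2A_{i-1}$ if $i$ is odd; $B_1=\{K_{1,3}\}$; for $i\ge2$, $B_i=\emptyset$ if $i$ is even and $B_i=\operatorname{join}(v,3B_{i-2})$ if $i$ is odd. For $D=0$, $B_0$ is taken to be empty (so $A_0\cup B_0=\{2K_1\}$). The diameter of a disconnected graph is $\infty$. *)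

(* Defs.v *)
From HB Require Import structures.
From mathcomp Require Import all_boot all_order all_algebra.
From mathcomp Require Import all_classical all_reals all_analysis.

Set Implicit Arguments.
Unset Strict Implicit.
Unset Printing Implicit Defensive.

Import Order.TTheory GRing.Theory Num.Theory.
Import numFieldNormedType.Exports.

Local Open Scope classical_set_scope.
Local Open Scope ring_scope.

Record sgraph := SGraph {
  vertex :> finType;
  adj : rel vertex;
  adj_sym : symmetric adj;
  adj_irr : irreflexive adj }.

(* The length of a shortest walk; the infimum of the empty set is +oo, which is
   the distance between two vertices of different components. *)
Definition dist (R : realType) (G : sgraph) (u v : G) : \bar R :=
  ereal_inf [set ((size p)%:R)%:E | p in
              [set p : seq G | path (@adj G) u p /\ last u p = v]].

Definition diameter (R : realType) (G : sgraph) : \bar R :=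
  ereal_sup [set d | exists u v : G, d = dist R u v].

Definition connected_in (G : sgraph) (S : {set G}) : Prop :=
  (exists x, x \in S) /\
  {in S &, forall x y,
    connect [rel a b | [&& adj a b, a \in S & b \in S]] x y}.

(* [H] is a minor of [G]: [phi] sends the vertices of [H] to disjoint connected
   branch sets whose contraction yields a supergraph of [H]. *)
Definition minor (H G : sgraph) : Prop :=
  exists phi : H -> {set G},
    [/\ forall x, connected_in (phi x),
        forall x y, x != y -> (phi x :&: phi y)%SET = finset.set0
      & forall x y, adj x y ->
          exists u v, [/\ u \in phi x, v \in phi y & adj u v]].

Section Drawing.
Variables (R : realType) (G : sgraph).

(* A drawing of [G] in the plane without crossings.  Each edge is parametrized
   in both directions, [arc v u] being [arc u v] run backwards; the values of
   [arc u v] outside [0, 1], or when [u], [v] are not adjacent, are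
   irrelevant. *)
Record plane_drawing := PlaneDrawing {
  pos : G -> R * R;
  arc : G -> G -> R -> R * R;
  pos_inj : injective pos;
  arc_cont : forall u v, adj u v -> {within `[0, 1], continuous (arc u v)};
  arc_inj : forall u v, adj u v -> {in `[0, 1] &, injective (arc u v)};
  arc_start : forall u v, adj u v -> arc u v 0 = pos u;
  arc_end : forall u v, adj u v -> arc u v 1 = pos v;
  arc_rev : forall u v, adj u v ->
    {in `[0, 1], forall t, arc v u t = arc u v (1 - t)};
  arc_vertex : forall u v w, adj u v ->
    {in `]0, 1[, forall t, arc u v t <> pos w};
  arc_arc : forall u v u' v', adj u v -> adj u' v' ->
    [set u; v]%SET != [set u'; v']%SET ->
    {in `]0, 1[ &, forall s t, arc u v s <> arc u' v' t} }.

Definition drawing_set (d : plane_drawing) : set (R * R) :=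
  range (pos d) `|`
  [set z | exists u v : G, adj u v /\ (arc d u v @` `[0, 1]) z].

Definition outer_face (d : plane_drawing) : set (R * R) :=
  [set z | (~` drawing_set d) z /\
           ~ bounded_set (connected_component (~` drawing_set d) z)].

(* All vertices lie on the boundary of the outer face; they never lie in the
   face itself, so this is membership in its closure. *)
Definition outerplanar : Prop :=
  exists d : plane_drawing, forall v : G, closure (outer_face d) (pos d v).

End Drawing.

Section EdgelessGraph.
Variable n : nat.

Definition edgeless_adj : rel 'I_n := fun _ _ => false.

Lemma edgeless_sym : symmetric edgeless_adj. Proof. by []. Qed.

Lemma edgeless_irr : irreflexive edgeless_adj. Proof. by []. Qed.

Definition edgeless := SGraph edgeless_sym edgeless_irr.

End EdgelessGraph.

Section Star.
Variable n : nat.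

(* [None] is the centre of K_{1,n}. *)
Definition star_adj : rel (option 'I_n) := fun x y => isSome x (+) isSome y.

Lemma star_sym : symmetric star_adj.
Proof. by move=> x y; rewrite /star_adj addbC. Qed.

Lemma star_irr : irreflexive star_adj.
Proof. by move=> x; rewrite /star_adj addbb. Qed.

Definition star := SGraph star_sym star_irr.

End Star.

Section DisjointUnion.
Variables (i : nat) (F : 'I_i -> sgraph).

Definition dunion_adj : rel {k : 'I_i & F k} := fun x y =>
  (tag x == tag y) && adj (tagged x) (tagged_as x y).

Lemma dunion_sym : symmetric dunion_adj.
Proof.
move=> [k x] [l y]; rewrite /dunion_adj.
case: (eqVneq k l) => [kl|//].
by case: l / kl y => y; rewrite !tagged_asE adj_sym.
Qed.

Lemma dunion_irr : irreflexive dunion_adj.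
Proof. by move=> [k x]; rewrite /dunion_adj tagged_asE adj_irr andbF. Qed.

Definition dunion := SGraph dunion_sym dunion_irr.

(* [None] is the new vertex; it is joined to the [k]-th graph by the single edge
   ending in [a k]. *)
Variable a : forall k, F k.

Definition join_adj : rel (option {k : 'I_i & F k}) := fun x y =>
  match x, y with
  | Some x, Some y => dunion_adj x y
  | Some x, None | None, Some x => tagged x == a (tag x)
  | None, None => false
  end.

Lemma join_sym : symmetric join_adj.
Proof. by move=> [x|] [y|] //=; apply: dunion_sym. Qed.

Lemma join_irr : irreflexive join_adj.
Proof. by move=> [x|] //=; apply: dunion_irr. Qed.

Definition join_graph := SGraph join_sym join_irr.

End DisjointUnion.

(* Predicates rather than [set sgraph], which is a universe inconsistency. *)
Definition family := sgraph -> Prop.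

Definition copies (i : nat) (X : family) : family := fun H =>
  exists F : 'I_i -> sgraph, (forall k, X (F k)) /\ H = dunion F.

Definition join_copies (i : nat) (X : family) : family := fun H =>
  exists (F : 'I_i -> sgraph) (a : forall k, F k),
    (forall k, X (F k)) /\ H = join_graph a.

Fixpoint famB (n : nat) : family :=
  match n with
  | 0 => fun=> False
  | 1 => fun H => H = star 3
  | m.+2 => if odd n then join_copies 3 (famB m) else fun=> False
  end.

Fixpoint famA (n : nat) : family :=
  match n with
  | 0 => fun H => H = edgeless 2
  | m.+1 => if odd n then copies 2 (famA m) else copies 2 (famB m)
  end.

(* Main.v *)
Require Import Defs.
From mathcomp Require Import all_boot all_order all_algebra.
From mathcomp Require Import all_classical all_reals all_analysis.
From mathcomp Require Import lra zify.
From Stdlib Require Import Btauto.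

Set Implicit Arguments.
Unset Strict Implicit.
Unset Printing Implicit Defensive.

Import Order.TTheory GRing.Theory Num.Theory.
Import numFieldNormedType.Exports.

(* The drawing is used only through a tournament on the vertices.  Fix a point P
   far away and join it to every vertex x by a ray avoiding all the edges that
   are not incident to x.  Let w(x, y) be the sum modulo 2 of the winding parity
   of the ray of x around y, of that of the ray of y around x, and of the bit
   telling which of x, y is the lower one.  Then w is a tournament, and
   w(u,x) + w(u,y) + w(v,x) + w(v,y) = 0 for disjoint edges uv, xy.  By
   telescoping, the same holds for u, v in a connected set and x, y in another
   connected set disjoint from it; adding up these equations over the pairs of
   independent edges of K_4 or K_{2,3} gives 0 = 1, so G has no such minor.

   Write b_0 = K_1 and b_(k+1) = join(v, 3 b_k), so that B_(2k+1) = b_(k+1),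
   A_(2k) = 2 b_k and A_(2k+1) = 4 b_k.  If S is a model of b_k and T is
   connected and disjoint from S, then some x in S is at distance > k from T:
   by the exclusion of K_{2,3}, some branch of S has no neighbour in T, and one
   concludes by induction, replacing T by its closed neighbourhood.  Applied
   twice, this settles A_(2k).  If all distances are at most 2k+1, then every
   ball of radius k+1 meets every model of b_k; enlarging two branches of a
   model of b_(k+1) by balls of radius k then gives a K_4 minor.  Finally, let T
   be a connected set of maximum size among those missing some part of a model
   of 4 b_k: T contains the other three parts, and the missed one, enlarged by a
   ball of radius k disjoint from T, is adjacent to all of them. *)

(** Puts sums modulo 2 in terms of [xorb], the form in which [btauto] decides Boolean identities. *)
Lemma addb_xorb a b : a (+) b = xorb a b.
Proof. by case: a b => [] []. Qed.

(** * Winding parities of discrete chains in the plane *)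

Section Crossings.
Local Open Scope ring_scope.
Variable R : realFieldType.
Implicit Types (p q x y : R * R) (s t : seq (R * R)) (d e : R).

(* Ties are broken by the abscissae, so that exactly one of two distinct points
   is above the other. *)
Definition above p q := (q.2 < p.2) || ((q.2 == p.2) && (q.1 < p.1)).

(* The step from [x] to [y] crosses the horizontal ray going right from [q],
   provided that it is short with respect to its distance to [q]. *)
Definition crosses q x y := (above x q (+) above y q) && (q.1 *+ 2 < x.1 + y.1).

Fixpoint crossings q x s :=
  if s is y :: s' then crosses q x y (+) crossings q y s' else false.

Definition near_pt d p q := (`|p.1 - q.1| < d) && (`|p.2 - q.2| < d).

Definition far_pt e p q := (e <= `|p.1 - q.1|) || (e <= `|p.2 - q.2|).

Lemma above_anti p q : p <> q -> above q p = ~~ above p q.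
Proof.
case: p q => [p1 p2] [q1 q2] npq; rewrite /above /=.
case: (ltgtP p2 q2) => //= E; case: (ltgtP p1 q1) => //= E'.
by case: npq; rewrite E E'.
Qed.

Lemma far_ptC e p q : far_pt e p q = far_pt e q p.
Proof. by rewrite /far_pt distrC (distrC p.2). Qed.

(** When [a] differs from [q] and [q'], this tells, in the sense of [crosses], whether the step from
    [q] to [q'] meets the ray going left from [a]. *)
Definition edge_defect q q' a := crosses a q q' (+) above a q (+) above a q'.

(* The differences of two short steps far apart bound a parallelogram that does
   not contain 0.  The terms [above] come from viewing the second step from the
   first one: this turns the ray used in [crosses] by a half turn. *)
Lemma crosses_cell d p p' q q' : near_pt d p p' -> near_pt d q q' ->
    far_pt (4 * d) p q ->
  crosses q p p' (+) crosses q' p p' =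
  edge_defect q q' p (+) edge_defect q q' p'.
Proof.
case: p p' q q' => [a b] [a' b'] [c e] [c' e'].
rewrite /near_pt /far_pt /= !ltr_norml => /andP[/andP[? ?] /andP[? ?]].
move=> /andP[/andP[? ?] /andP[? ?]] far.
have upT (x y u v : R) : x < y -> above (u, y) (v, x) = true.
  by move=> xy; rewrite /above /= xy.
have upF (x y u v : R) : x < y -> above (u, x) (v, y) = false.
  by move=> xy; rewrite /above /= lt_gtF //= gt_eqF.
rewrite /edge_defect.
(* At vertical distance at least [2 * d] the four comparisons of heights agree, so that both sides
   vanish. *)
have [v|v] := leP (2 * d) `|b - e|.
  case: (ger0P (b - e)) v => h v.
    have [h1 h2 h3 h4] : [/\ e < b, e' < b, e < b' & e' < b'] by split; lra.
    rewrite /crosses !(upT _ _ _ _ h1, upT _ _ _ _ h2, upT _ _ _ _ h3) //.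
    rewrite !(upT _ _ _ _ h4, upF _ _ _ _ h1, upF _ _ _ _ h2) //.
    by rewrite !(upF _ _ _ _ h3, upF _ _ _ _ h4).
  have [h1 h2 h3 h4] : [/\ b < e, b < e', b' < e & b' < e'] by split; lra.
  rewrite /crosses !(upT _ _ _ _ h1, upT _ _ _ _ h2, upT _ _ _ _ h3) //.
  rewrite !(upT _ _ _ _ h4, upF _ _ _ _ h1, upF _ _ _ _ h2) //.
  by rewrite !(upF _ _ _ _ h3, upF _ _ _ _ h4).
have {far} : 4 * d <= `|a - c| by case/orP: far => // h; lra.
move: v; rewrite ltr_norml => /andP[? ?] h.
have [neq neq' n'eq n'eq'] : [/\ (a, b) <> (c, e), (a, b) <> (c', e'),
    (a', b') <> (c, e) & (a', b') <> (c', e')].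
  by case: (ger0P (a - c)) h => ? ?; split=> -[? _]; lra.
rewrite /crosses.
rewrite (above_anti neq) (above_anti neq').
rewrite (above_anti n'eq) (above_anti n'eq').
rewrite /=.
(* The sign of [a - c] decides every test on abscissae: either both sides are the sum of the four
   comparisons of heights, or both are 0. *)
case: (ger0P (a - c)) h => ? ?.
  have -> : c *+ 2 < a + a' by lra.
  have -> : c' *+ 2 < a + a' by lra.
  have -> : (a *+ 2 < c + c') = false by apply/negbTE; rewrite -leNgt; lra.
  have -> : (a' *+ 2 < c + c') = false by apply/negbTE; rewrite -leNgt; lra.
  by case: (above (a, b) (c, e)); case: (above (a, b) (c', e'));
    case: (above (a', b') (c, e)); case: (above (a', b') (c', e')).
have -> : (c *+ 2 < a + a') = false by apply/negbTE; rewrite -leNgt; lra.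
have -> : (c' *+ 2 < a + a') = false by apply/negbTE; rewrite -leNgt; lra.
have -> : a *+ 2 < c + c' by lra.
have -> : a' *+ 2 < c + c' by lra.
by case: (above (a, b) (c, e)); case: (above (a, b) (c', e'));
  case: (above (a', b') (c, e)); case: (above (a', b') (c', e')).
Qed.

(** Summing [crosses_cell] along [s], the contributions of the inner vertices cancel in pairs. *)
Lemma crossings_strip d p s q q' : path (near_pt d) p s -> near_pt d q q' ->
    {in p :: s, forall x, far_pt (4 * d) x q} ->
  crossings q p s (+) crossings q' p s =
  edge_defect q q' p (+) edge_defect q q' (last p s).
Proof.
elim: s p => [|y s IH] p /=; first by rewrite addbb.
move=> /andP[py ys] qq far; rewrite addbACA (crosses_cell py qq); last first.
  exact/far/mem_head.
rewrite IH //; last by move=> x xs; apply/far/mem_behead.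
by rewrite -addbA addKb.
Qed.

(** The sum of [edge_defect] over the steps of the chain, after cancellation of the inner terms
    [above]. *)
Definition chain_defect q t a :=
  crossings a q t (+) above a q (+) above a (last q t).

(** A second telescoping, along [t]. It trades the change of the winding parity of [s] between the
    ends of [t] for that of [t] between the ends of [s], up to comparisons of heights. *)
Lemma crossings_grid d p s q t : path (near_pt d) p s -> path (near_pt d) q t ->
    {in p :: s & q :: t, forall x y, far_pt (4 * d) x y} ->
  crossings q p s (+) crossings (last q t) p s =
  chain_defect q t p (+) chain_defect q t (last p s).
Proof.
move=> ps; elim: t q => [|y t IH] q /=.
  by rewrite /chain_defect /= !addbb.
move=> /andP[qy yt] far.
have <- : crossings q p s (+) crossings y p s (+) (crossings y p s (+)
   crossings (last y t) p s) = crossings q p s (+) crossings (last y t) p s.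
  by rewrite -addbA addKb.
rewrite IH //; last by move=> x z xs zt; apply: far => //; rewrite mem_behead.
rewrite (crossings_strip ps qy); last first.
  by move=> x xs; apply: far; rewrite ?mem_head.
by rewrite /chain_defect /edge_defect /= !addb_xorb; btauto.
Qed.

(** The mesh [d] is existential because each pair of chains is compared at its own scale. *)
Definition clear_chains p s q t := exists d, [/\ path (near_pt d) p s,
  path (near_pt d) q t & {in p :: s & q :: t, forall x y, far_pt (4 * d) x y}].

(* The tournament; [r] and [r'] are the rays from [P] to [x] and [y]. *)
Definition ray_order (P x y : R * R) r r' :=
  crossings y P r (+) crossings x P r' (+) above x y.

(** The sum of [crossings_grid] over the four pairs made of a ray and the opposite edge, and over
    the pair of edges. Two rays are never compared: they all start at [P]. *)
Lemma ray_order_quad P u v x y ru rv rx ry (e f : seq (R * R)) :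
    [/\ last P ru = u, last P rv = v, last P rx = x & last P ry = y] ->
    last u e = v -> last x f = y ->
    clear_chains P ru x f -> clear_chains P rv x f ->
    clear_chains u e P rx -> clear_chains u e P ry ->
    clear_chains u e x f ->
  ray_order P u x ru rx (+) ray_order P u y ru ry =
  ray_order P v x rv rx (+) ray_order P v y rv ry.
Proof.
move=> [eu ev ex ey] uv xy [d1 [p1 q1 s1]] [d2 [p2 q2 s2]].
move=> [d3 [p3 q3 s3]] [d4 [p4 q4 s4]] [d5 [p5 q5 s5]].
have g1 := crossings_grid p1 q1 s1; have g2 := crossings_grid p2 q2 s2.
have g3 := crossings_grid p3 q3 s3; have g4 := crossings_grid p4 q4 s4.
have g5 := crossings_grid p5 q5 s5; move: g1 g2 g3 g4 g5.
rewrite /chain_defect /ray_order uv xy eu ev ex ey.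
move=> h1 h2 h3 h4 h5.
have {h1 h2 h3 h4 h5} := congr2 addb h1 (congr2 addb h2
  (congr2 addb h3 (congr2 addb h4 h5))).
set a := (X in X = _ -> _); set b := (X in _ = X -> _) => ab.
set c := LHS; set d := RHS.
have: c (+) d = a (+) b by rewrite /a /b /c /d !addb_xorb; btauto.
by rewrite ab addbb => /(canRL (addbK _)).
Qed.

End Crossings.

(** * Connected sets and continua in the plane *)

Section Continua.
Local Open Scope classical_set_scope.
Local Open Scope ring_scope.
Variable R : realType.
Implicit Types (x y z : R * R) (A B C U : set (R * R)).

Lemma near_ptP e x y : reflect (ball x e y) (near_pt e x y).
Proof.
rewrite /ball /= /prod_ball -!ball_normE /ball_ /near_pt /=.
exact: andP.
Qed.

Lemma far_ptN e x y : far_pt e x y = ~~ near_pt e x y.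
Proof. by rewrite /far_pt /near_pt negb_and -!leNgt. Qed.

Lemma open_ball_sub U x : open U -> U x -> exists2 e, 0 < e & ball x e `<=` U.
Proof.
move=> oU Ux; have /nbhs_ballP[e e0 eU] : nbhs x U by exact: open_nbhs_nbhs.
by exists e.
Qed.

Lemma compact_closed_far A B : compact A -> closed B -> A `&` B = set0 ->
  exists2 e, 0 < e & forall x y, A x -> B y -> far_pt e x y.
Proof.
move=> /compact_near_coveringP cA cB AB.
have near_far : \forall e \near (0^'+ : set_system R),
    A `<=` (fun x => forall y, B y -> far_pt e x y).
  apply: cA => x Ax.
  have nBx : (~` B) x by move=> Bx; move: AB; rewrite -subset0 => /(_ x); apply.
  have [e e0 eB] := open_ball_sub (closed_openC cB) nBx.
  exists (ball x (e / 2), [set t | t < e / 2]) => /=.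
    split; first by apply: nbhsx_ballx; rewrite divr_gt0.
    by apply: nbhs_right_lt; rewrite divr_gt0.
  move=> [x' t] /= [xx' te] y By; rewrite far_ptN; apply/near_ptP => x'y.
  apply: (eB y) By; rewrite [e]splitr; apply: ball_triangle xx' _.
  exact: le_ball (ltW te) _ x'y.
have [e [/= e0 H]] := filter_ex (filterI (nbhs_right_gt (0 : R)) near_far).
by exists e => // x y /H; apply.
Qed.

(** The points reached by such chains form a nonempty, relatively open and closed subset of [A]. *)
Lemma bounded_chain A d x y : connected A -> 0 < d -> A x -> A y ->
  exists s, [/\ path (near_pt d) x s, last x s = y &
    {in x :: s, forall z, A z}].
Proof.
move=> cA d0 Ax Ay.
pose B := [set z | exists s, [/\ path (near_pt d) x s, last x s = z &
  {in x :: s, forall z, A z}]].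
have step z z' : B z -> near_pt d z z' -> A z' -> B z'.
  move=> [s [ps ls sA]] zz' Az'; exists (rcons s z'); split.
  - by rewrite rcons_path ps ls.
  - by rewrite last_rcons.
  - by move=> t; rewrite -rcons_cons mem_rcons inE => /orP[/eqP->|/sA].
have BA : B `<=` A by move=> z [s [_ <- sA]]; apply/sA/mem_last.
suff BE : B = A by change (B y); rewrite BE.
apply: cA.
- by exists x, [::]; split=> // z; rewrite inE => /eqP->.
- exists (\bigcup_(z in B) (ball z d)).
    by apply: bigcup_open => z _; exact: ball_open.
  apply/seteqP; split=> [z Bz|z [Az [z' Bz' zz']]].
    by split; [exact: BA|exists z => //; exact: ballxx].
  exact: step Bz' (introT (near_ptP _ _ _) zz') Az.
- exists (closure B); first exact: closed_closure.
  apply/seteqP; split=> [z Bz|z [Az clz]].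
    by split; [exact: BA|exact: subset_closure].
  have [z' [Bz' zz']] := clz _ (nbhsx_ballx z d d0).
  by apply: step Bz' _ Az; apply/near_ptP/ball_sym.
Qed.

Definition segment x y : set (R * R) :=
  (fun t : R => (x.1 + t * (y.1 - x.1), x.2 + t * (y.2 - x.2))) @` `[0, 1].

Lemma segment_continuum x y :
  [/\ compact (segment x y), connected (segment x y), segment x y x &
      segment x y y].
Proof.
have c : continuous
    (fun t : R => (x.1 + t * (y.1 - x.1), x.2 + t * (y.2 - x.2))).
  move=> t; apply: (@cvg_pair _ _ _ _ (nbhs (x.1 + t * (y.1 - x.1)))
    (nbhs (x.2 + t * (y.2 - x.2)))) => /=;
  by apply: cvgD; [exact: cvg_cst|apply: cvgM; [exact: cvg_id|exact: cvg_cst]].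
split.
- apply: continuous_compact; last exact: segment_compact.
  exact: continuous_subspaceT.
- apply: connected_continuous_connected; first exact: segment_connected.
  exact: continuous_subspaceT.
- exists 0; first by rewrite /= in_itv /= lexx ler01.
  by rewrite !mul0r !addr0 -surjective_pairing.
- exists 1; first by rewrite /= in_itv /= lexx ler01.
  by rewrite !mul1r !subrKC -surjective_pairing.
Qed.

Lemma segment_ball x y e : ball x e y -> segment x y `<=` ball x e.
Proof.
move=> /near_ptP/andP[]; rewrite !ltr_norml => h1 h2 _ [t + <-].
rewrite /= in_itv /= => t01.
by apply/near_ptP; rewrite /near_pt !ltr_norml /=; apply/andP; split; nra.
Qed.

Lemma connected_componentS U V x : U `<=` V ->
  connected_component U x `<=` connected_component V x.
Proof.
by move=> UV y [B [Bx BU cB] By]; exists B => //; split=> // z /BU/UV.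
Qed.

Lemma segment_component U x y : segment x y `<=` U -> connected_component U x y.
Proof.
by move=> sU; have [_ c sx sy] := segment_continuum x y; exists (segment x y).
Qed.

(** The points reached are again relatively open and closed, since a short segment prolongs a
    continuum. Compactness will keep a ray at a positive distance from the edges that it avoids. *)
Lemma open_component_continuum U x y : open U -> connected_component U x y ->
  exists C, [/\ compact C, connected C, C x, C y & C `<=` U].
Proof.
move=> oU [A [Ax AU cA] Ay].
pose B := [set z | exists C, [/\ compact C, connected C, C x, C z & C `<=` U]].
have glue z z' D : B z ->
    [/\ compact D, connected D, D z & D z'] -> D `<=` U -> B z'.
  move=> [C [kC cC Cx Cz CU]] [kD cD Dz Dz'] DU; exists (C `|` D); split.
  - exact: compactU.
  - by apply: connectedU => //; exists z.
  - by left.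
  - by right.
  - by move=> t [/CU|/DU].
have BU : B `<=` U by move=> z [C [_ _ _ Cz]]; exact.
have oB : open B.
  rewrite openE => z Bz; have [e e0 eU] := open_ball_sub oU (BU _ Bz).
  apply: filterS (nbhsx_ballx z e e0) => z' zz'.
  by apply: glue Bz (segment_continuum z z') _ => t /(segment_ball zz')/eU.
have Bx : B x by exists [set x]; split=> [||||t ->] //; [exact: compact_set1|
  exact: connected1|exact: AU].
suff AB : A `&` B = A by move: Ay; rewrite -AB => -[].
apply: cA; first by exists x.
  by exists B.
exists (closure B); first exact: closed_closure.
apply/seteqP; split=> z [Az].
  by move=> Bz; split=> //; exact: subset_closure.
move=> clz; split=> //; have [e e0 eU] := open_ball_sub oU (AU _ Az).
have [z' [Bz' zz']] := clz _ (nbhsx_ballx z e e0).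
have [kD cD Dz Dz'] := segment_continuum z z'.
by apply: (@glue z' z (segment z z')) => // t /(segment_ball zz')/eU.
Qed.

Definition outside (M : R) : set (R * R) :=
  [set z | (M <= `|z.1|) || (M <= `|z.2|)].

(** [outside M] is a union of four half-planes. Segments suffice inside each of them, and corners of
    the square lead from one to the next. *)
Lemma outside_component M z : outside M z ->
  connected_component (outside M) z (M, M).
Proof.
have hp (a b : R * R) : [\/ M <= a.1 /\ M <= b.1, M <= a.2 /\ M <= b.2,
    a.1 <= - M /\ b.1 <= - M | a.2 <= - M /\ b.2 <= - M] ->
    connected_component (outside M) a b.
  move=> ab; apply: segment_component => _ [t + <-].
  rewrite /= in_itv /= => t01; rewrite /outside /= !ler_normr.
  by case: ab => -[h1 h2]; apply/orP; [left|right|left|right]; apply/orP;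
    [left|left|right|right]; nra.
rewrite /outside /= !ler_normr => /orP[]/orP[] h.
- by apply: hp; constructor 1.
- apply: (@connected_component_trans _ _ (- M, M)); apply: hp.
    by constructor 3 => /=; lra.
  by constructor 2.
- by apply: hp; constructor 2.
- apply: (@connected_component_trans _ _ (M, - M)); apply: hp.
    by constructor 4 => /=; lra.
  by constructor 1.
Qed.

Lemma unbounded_outside M A : ~ bounded_set A -> exists2 z, A z & outside M z.
Proof.
move=> nb; apply: contrapT => H; apply: nb.
exists M; split; first exact: num_real.
move=> N MN z Az /=; rewrite prod_normE /= ge_max.
have nO : ~ outside M z by move=> Oz; apply: H; exists z.
move: nO; rewrite /outside /= => /negP; rewrite negb_or -!ltNge => /andP[h1 h2].
by apply/andP; split; apply: ltW; [apply: lt_trans h1 _|apply: lt_trans h2 _].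
Qed.

Lemma compact_inside A : compact A -> exists M, A `<=` ~` outside M.
Proof.
move=> /compact_bounded[M [_ H]]; exists (M + 2) => z Az.
have /(_ z Az) /= : globally A [set x | `|x| <= M + 1].
  by apply: H; rewrite ltrDl ltr01.
rewrite prod_normE /= ge_max => /andP[h1 h2].
by rewrite /outside /= => /orP[] h; lra.
Qed.

Lemma finite_union_compact (I : finType) (P : I -> Prop)
    (F : I -> set (R * R)) :
  (forall i, P i -> compact (F i)) -> compact (\bigcup_(i in P) F i).
Proof.
move=> cF; rewrite bigcup_mkcond.
have -> : [set: I] = [set` enum I].
  by apply/seteqP; split=> i //= _; rewrite mem_enum.
rewrite bigcup_seq; apply: bigsetU_compact => i _.
by case: ifPn => [/set_mem/cF //|_]; exact: compact0.
Qed.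

End Continua.

(** * From an outerplanar drawing to the tournament *)

Section Rays.
Local Open Scope classical_set_scope.
Local Open Scope ring_scope.
Variables (R : realType) (G : sgraph) (d : plane_drawing R G).

Let edge (p : G * G) : set (R * R) := Defs.arc d p.1 p.2 @` `[0, 1].

Let edge_continuum p : adj p.1 p.2 ->
  [/\ compact (edge p), connected (edge p), edge p (pos d p.1) &
      edge p (pos d p.2)].
Proof.
move=> e; split.
- by apply: continuous_compact; [exact: arc_cont|exact: segment_compact].
- apply: connected_continuous_connected; first exact: segment_connected.
  exact: arc_cont.
- by exists 0; [rewrite /= in_itv /= lexx ler01|exact: arc_start].
- by exists 1; [rewrite /= in_itv /= lexx ler01|exact: arc_end].
Qed.

Let interior_or (t : R) : t \in `[0, 1] -> [\/ t = 0, t = 1 | t \in `]0, 1[].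
Proof.
rewrite !in_itv /= => /andP[]; rewrite !le_eqVlt => /orP[/eqP<-|h0].
  by constructor 1.
by move=> /orP[/eqP->|h1]; [constructor 2|constructor 3; rewrite h0].
Qed.

Let edge_vertex u v w : adj u v -> edge (u, v) (pos d w) -> w = u \/ w = v.
Proof.
move=> uv [t + tw]; rewrite /= in_itv => /interior_or[] t0; subst.
- by left; apply: (pos_inj (p := d)); rewrite -(arc_start d uv).
- by right; apply: (pos_inj (p := d)); rewrite -(arc_end d uv).
- by case: (@arc_vertex _ _ d _ _ w uv _ t0).
Qed.

Let edge_edge u v x y : adj u v -> adj x y ->
    [/\ u != x, u != y, v != x & v != y] -> edge (u, v) `&` edge (x, y) = set0.
Proof.
move=> uv xy [ux uy vx vy]; rewrite -subset0 => z [uvz xyz].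
case: (uvz) => s; rewrite /= in_itv /= => /interior_or[] si sz.
- move: sz xyz; rewrite si arc_start // => <- /(edge_vertex xy)[] /eqP.
    by rewrite (negPf ux).
  by rewrite (negPf uy).
- move: sz xyz; rewrite si arc_end // => <- /(edge_vertex xy)[] /eqP.
    by rewrite (negPf vx).
  by rewrite (negPf vy).
case: (xyz) => t; rewrite /= in_itv /= => /interior_or[] ti tz.
- move: tz uvz; rewrite ti arc_start // => <- /(edge_vertex uv)[] /eqP.
    by rewrite eq_sym (negPf ux).
  by rewrite eq_sym (negPf vx).
- move: tz uvz; rewrite ti arc_end // => <- /(edge_vertex uv)[] /eqP.
    by rewrite eq_sym (negPf uy).
  by rewrite eq_sym (negPf vy).
apply: (@arc_arc _ _ d _ _ _ _ uv xy _ s t si ti); last by rewrite sz tz.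
apply/eqP => /setP/(_ u); rewrite !inE eqxx (negPf ux) (negPf uy).
by [].
Qed.

Lemma drawing_compact : compact (drawing_set d).
Proof.
have -> : drawing_set d = (\bigcup_(v in [set: G]) [set pos d v]) `|`
    (\bigcup_(p in [set p : G * G | adj p.1 p.2]) edge p).
  apply/seteqP; split=> z.
    move=> [[v _ <-]|[u [v [uv uvz]]]]; first by left; exists v.
    by right; exists (u, v).
  by move=> [[v _ ->]|[[u v] uv uvz]]; [left; exists v|right; exists u, v].
apply: compactU; apply: finite_union_compact => i.
  by move=> _; exact: compact_set1.
by case/edge_continuum.
Qed.

Let avoid u :=
  \bigcup_(p in [set p | [&& adj p.1 p.2, p.1 != u & p.2 != u]]) edge p.

Let avoid_compact u : compact (avoid u).
Proof.
by apply: finite_union_compact => i /and3P[/edge_continuum[]].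
Qed.

Let closed_compact (A : set (R * R)) : compact A -> closed A.
Proof. by apply: compact_closed; exact: norm_hausdorff. Qed.

(** A short segment from [pos d u] missing [avoid u] reaches the outer face; the unbounded component
    found there leads out of a square containing the drawing, and then to the corner [(M, M)]. *)
Lemma outer_rays : (forall v, closure (outer_face d) (pos d v)) ->
  exists P : R * R, forall u, exists C : set (R * R),
    [/\ compact C, connected C, C P, C (pos d u) & C `<=` ~` avoid u].
Proof.
move=> outer; have [M HM] := compact_inside drawing_compact; exists (M, M) => u.
have oU : open (~` avoid u).
  by apply: closed_openC; apply: closed_compact; exact: avoid_compact.
have KU : ~` drawing_set d `<=` ~` avoid u.
  apply: subsetC => z [[v w] /= /and3P[vw _ _] vwz].
  by right; exists v, w.
have Uu : (~` avoid u) (pos d u).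
  move=> [[v w] /= /and3P[vw vu wu]] /(edge_vertex vw)[] /eqP.
    by rewrite eq_sym (negPf vu).
  by rewrite eq_sym (negPf wu).
have [e e0 eU] := open_ball_sub oU Uu.
apply: open_component_continuum oU _.
have [z [[Kz unb] uz]] := outer u _ (nbhsx_ballx _ e e0).
have [p zp Op] := unbounded_outside M unb.
apply: (connected_component_trans (y := z)); last first.
  apply: connected_component_sym; apply: segment_component.
  by move=> t /(segment_ball uz)/eU.
apply: connected_component_sym; apply: connected_componentS KU _ _.
apply: connected_component_trans zp _.
apply: connected_componentS (outside_component Op) => t Ot Kt.
exact: HM Kt Ot.
Qed.

Lemma near_path_le (d1 d2 : R) p s : d1 <= d2 ->
  path (near_pt d1) p s -> path (near_pt d2) p s.
Proof.
move=> d12; apply: sub_path => a b /near_ptP ab; apply/near_ptP.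
exact: le_ball d12 _ ab.
Qed.

Lemma outer_order : (forall v, closure (outer_face d) (pos d v)) ->
  exists w : G -> G -> bool,
    (forall x y, x != y -> w y x = ~~ w x y) /\
    (forall u v x y, adj u v -> adj x y ->
      [/\ u != x, u != y, v != x & v != y] ->
      w u x (+) w u y = w v x (+) w v y).
Proof.
move=> /outer_rays[P rays].
(* [r u] consists of a mesh and of a chain of that mesh. Dividing the distance [e] by 4 provides the
   bound [4 * d] of [clear_chains]. *)
have /choice[r rP] : forall u, exists r : R * seq (R * R),
    [/\ 0 < r.1, path (near_pt r.1) P r.2, last P r.2 = pos d u &
      {in P :: r.2, forall z y, avoid u y -> far_pt (4 * r.1) z y}].
  move=> u; have [C [kC cC CP Cu Cav]] := rays u.
  have Cav0 : C `&` avoid u = set0 by rewrite -subset0 => z [/Cav].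
  have cl := closed_compact (@avoid_compact u).
  have [e e0 far] := compact_closed_far kC cl Cav0.
  have e40 : 0 < e / 4 by rewrite divr_gt0.
  have [s [ps ls sC]] := bounded_chain cC e40 CP Cu.
  exists (e / 4, s); split=> //= z zs y yav.
  by rewrite mulrC divfK //; apply: far yav; exact: sC.
exists (fun x y => ray_order P (pos d x) (pos d y) (r x).2 (r y).2); split.
  (* Exchanging [x] and [y] permutes the two winding parities and negates [above]. *)
  move=> x y xy; rewrite /ray_order (@above_anti _ (pos d x)); last first.
    by move=> /(pos_inj (p := d)) /eqP; rewrite (negPf xy).
  by rewrite addbN (addbC (crossings (pos d x) _ _)).
move=> u v x y uv xy [ux uy vx vy].
have [kuv cuv uvu uvv] := edge_continuum (p := (u, v)) uv.
have [kxy cxy xyx xyy] := edge_continuum (p := (x, y)) xy.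
have disj := edge_edge uv xy (And4 ux uy vx vy).
have [e e0 far] := compact_closed_far kuv (closed_compact kxy) disj.
have [[du pu lu fu] [dv pv lv fv]] := (rP u, rP v).
have [[dx px lx fx] [dy py ly fy]] := (rP x, rP y).
(* With this mesh, the chains along the two edges are fine enough for all five comparisons. *)
pose m := Num.min
  (Num.min (Num.min (r u).1 (r v).1) (Num.min (r x).1 (r y).1)) (e / 4).
have m0 : 0 < m by rewrite !lt_min du dv dx dy divr_gt0.
have [mu mv mx my me] : [/\ m <= (r u).1, m <= (r v).1, m <= (r x).1,
    m <= (r y).1 & m <= e / 4].
  by rewrite /m !ge_min !lexx !orbT.
have [s [ps ls sA]] := bounded_chain cuv m0 uvu uvv.
have [t [pt lt tA]] := bounded_chain cxy m0 xyx xyy.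
have av_xy a z : a != x -> a != y -> edge (x, y) z -> avoid a z.
  by move=> ax ay xyz; exists (x, y) => //=; rewrite xy !(eq_sym _ a) ax ay.
have av_uv a z : a != u -> a != v -> edge (u, v) z -> avoid a z.
  by move=> au av uvz; exists (u, v) => //=; rewrite uv !(eq_sym _ a) au av.
apply: (ray_order_quad (e := s) (f := t)) => //.
- exists (r u).1; split=> //; first exact: near_path_le pt.
  by move=> a b aP bt; apply: fu => //; apply: av_xy => //; exact: tA.
- exists (r v).1; split=> //; first exact: near_path_le pt.
  by move=> a b aP bt; apply: fv => //; apply: av_xy => //; exact: tA.
- exists (r x).1; split=> //; first exact: near_path_le ps.
  move=> a b aP bt; rewrite far_ptC; apply: fx => //.
  by apply: av_uv; rewrite 1?eq_sym //; exact: sA.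
- exists (r y).1; split=> //; first exact: near_path_le ps.
  move=> a b aP bt; rewrite far_ptC; apply: fy => //.
  by apply: av_uv; rewrite 1?eq_sym //; exact: sA.
exists (e / 4); split; [exact: near_path_le ps|exact: near_path_le pt|].
by move=> a b /sA Aa /tA Ab; rewrite mulrC divfK //; exact: far.
Qed.

End Rays.

(* Shadows the homonymous lemmas of [classical_sets]. *)
From mathcomp Require Import fintype finset.

(** * Connected sets, balls and nested models in a graph *)

Section Graphs.
Variable G : sgraph.
Implicit Types (A B C S T : {set G}) (a b x y : G).

Definition touch A B := [exists a in A, exists b in B, adj a b].

Lemma touchP A B :
  reflect (exists a b, [/\ a \in A, b \in B & adj a b]) (touch A B).
Proof.
apply: (iffP exists_inP) => [[a aA /exists_inP[b bB ab]]|[a [b [aA bB ab]]]].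
  by exists a, b.
by exists a => //; apply/exists_inP; exists b.
Qed.

Lemma touchC A B : touch A B = touch B A.
Proof.
by apply/touchP/touchP => -[a [b [aA bB ab]]]; exists b, a; rewrite adj_sym.
Qed.

Lemma touchS A A' B B' :
  A \subset A' -> B \subset B' -> touch A B -> touch A' B'.
Proof.
move=> /subsetP sA /subsetP sB /touchP[a [b [aA bB ab]]].
by apply/touchP; exists a, b; split; [exact: sA|exact: sB|].
Qed.

Let within A : rel G := [rel a b | [&& adj a b, a \in A & b \in A]].

Let within_sym A : connect_sym (within A).
Proof.
apply: sym_connect_sym => a b.
by rewrite /within /= adj_sym (andbC (a \in A)).
Qed.

Let within_sub A B a b : A \subset B ->
  connect (within A) a b -> connect (within B) a b.
Proof.
move=> /subsetP AB; apply: connect_sub => x y /and3P[xy xA yA].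
by apply: connect1; rewrite /within /= xy !AB.
Qed.

Lemma connected_const (T : Type) (f : G -> T) A : connected_in A ->
  {in A &, forall a b, adj a b -> f a = f b} -> {in A &, forall a b, f a = f b}.
Proof.
move=> [_ cA] fA a b /cA /[apply] /connectP[p pp ->] {b}.
elim: p a pp => //= b p IH a /andP[/and3P[ab aA bA] /IH <-]; exact: fA.
Qed.

Lemma connected_root A r : r \in A ->
  (forall x, x \in A -> connect (within A) r x) -> connected_in A.
Proof.
move=> rA cA; split; first by exists r.
by move=> x y xA yA; apply: connect_trans (cA y yA); rewrite within_sym cA.
Qed.

Lemma connected_in1 x : connected_in [set x].
Proof. by apply: (connected_root (set11 x)) => y /set1P->. Qed.

Lemma connected_inU A B : connected_in A -> connected_in B ->
  touch A B || ~~ [disjoint A & B] -> connected_in (A :|: B).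
Proof.
move=> cA cB AB.
have [a [b [aA bB ab]]] : exists a b, [/\ a \in A, b \in B &
    connect (within (A :|: B)) a b].
  case/orP: AB => [/touchP[a [b [aA bB ab]]]|/pred0Pn[a /andP[/= aA aB]]].
    exists a, b; split=> //; apply: connect1.
    by rewrite /within /= ab !inE aA bB orbT.
  by exists a, a.
apply: (@connected_root _ a); first by rewrite inE aA.
move=> x /setUP[xA|xB].
  by apply: within_sub (subsetUl _ _) _; apply: cA.2.
by apply: connect_trans ab _; apply: within_sub (subsetUr _ _) _; apply: cB.2.
Qed.

Lemma connected_star (I : finType) (P : pred I) C (L : I -> {set G}) :
    connected_in C ->
    (forall i, P i -> connected_in (L i)) -> (forall i, P i -> touch C (L i)) ->
  connected_in (C :|: \bigcup_(i | P i) L i).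
Proof.
move=> cC cL tCL; have [[r rC] _] := cC.
apply: (@connected_root _ r); first by rewrite inE rC.
move=> x /setUP[xC|/bigcupP[i Pi xi]].
  by apply: within_sub (subsetUl _ _) _; apply: cC.2.
apply: (@within_sub (C :|: L i)); first exact/setUS/bigcup_sup.
apply: (connected_inU cC (cL _ Pi) _).2; first by rewrite tCL.
  by rewrite inE rC.
by rewrite inE xi orbT.
Qed.

Definition nbr S := S :|: [set y | touch S [set y]].

Definition gball S n := iter n nbr S.

Lemma sub_nbr S : S \subset nbr S.
Proof. exact: subsetUl. Qed.

Lemma sub_gball S n : S \subset gball S n.
Proof.
elim: n => [|n IH] /=; first exact: subxx.
exact: subset_trans IH (sub_nbr _).
Qed.

Lemma nbr_disjoint A B :
  [disjoint nbr A & B] = [disjoint A & B] && ~~ touch A B.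
Proof.
apply/idP/andP => [dAB|[dAB tAB]].
  split; first exact: disjointWl (sub_nbr A) dAB.
  apply/negP => /touchP[a [b [aA bB ab]]].
  move/pred0P/(_ b): dAB; rewrite /= bB andbT inE => /negP; apply.
  by apply/orP; right; rewrite inE; apply/touchP; exists a, b; rewrite inE.
apply/pred0P => b /=; apply/negP => /andP[/setUP[bA|+] bB].
  by move/pred0P/(_ b): dAB; rewrite /= bA bB.
rewrite inE => ab; case/negP: tAB; apply: touchS ab => //.
by rewrite sub1set.
Qed.

(** Both sides say that the distance between [A] and [B] exceeds [n]. *)
Lemma gball_disjointC A B n :
  [disjoint gball A n & B] = [disjoint A & gball B n].
Proof.
elim: n A => // n IH A; rewrite {1}/gball iterSr -/(gball (nbr A) n) IH.
rewrite nbr_disjoint [gball B n.+1]/(nbr _) touchC [in RHS]disjoint_sym.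
by rewrite nbr_disjoint disjoint_sym.
Qed.

Lemma gballD S m n : gball (gball S m) n = gball S (n + m).
Proof. by rewrite /gball iterD. Qed.

Lemma connected_nbr S : connected_in S -> connected_in (nbr S).
Proof.
move=> cS; rewrite /nbr.
have -> : [set y | touch S [set y]] = \bigcup_(y | touch S [set y]) [set y].
  apply/setP => y; rewrite inE; apply/idP/bigcupP => [ty|[z tz /set1P->//]].
  by exists y; rewrite ?set11.
by apply: connected_star => // y _; exact: connected_in1.
Qed.

Lemma connected_gball S n : connected_in S -> connected_in (gball S n).
Proof. by move=> cS; elim: n => //= n; exact: connected_nbr. Qed.

Lemma path_gball u p : path (@adj G) u p -> last u p \in gball [set u] (size p).
Proof.
elim/last_ind: p => [|p y IH]; first by rewrite set11.
rewrite rcons_path last_rcons size_rcons => /andP[/IH h py] /=.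
apply/setUP; right; rewrite inE; apply/touchP.
by exists (last u p), y; rewrite set11; split.
Qed.


Lemma disjoint_neq A B a b : [disjoint A & B] -> a \in A -> b \in B -> a != b.
Proof.
move=> dAB aA bB; apply/eqP => ab; move/pred0P/(_ a): dAB.
by rewrite /= aA ab bB.
Qed.

Lemma disjoint_setUl A B C :
  [disjoint A :|: B & C] = [disjoint A & C] && [disjoint B & C].
Proof. by rewrite -!setI_eq0 setIUl setU_eq0. Qed.

(** A model of K_{1,n} with centre [C]; further edges between the legs are allowed. *)
Definition spider n C (L : 'I_n -> {set G}) := [/\ connected_in C,
  forall i, connected_in (L i), forall i, [disjoint C & L i],
  forall i, touch C (L i) & forall i j, i != j -> [disjoint L i & L j]].

(* Mirrors the recursion of the families B: the subgraph induced by [S] is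
   partitioned into a model of a graph of B_(2k-1), with B_(-1) = {K_1}. *)
Fixpoint nested k S : Prop :=
  if k is k'.+1 then exists C (L : 'I_3 -> {set G}),
    [/\ spider C L, forall i, nested k' (L i) & S = C :|: \bigcup_i L i]
  else connected_in S.

Lemma nested_connected k S : nested k S -> connected_in S.
Proof.
case: k => // k [C [L [[cC cL _ tCL _] _ ->]]]; exact: connected_star.
Qed.

(** * Minors excluded by the tournament, and distant points *)

Variable w : G -> G -> bool.
Hypothesis w_anti : forall x y, x != y -> w y x = ~~ w x y.
Hypothesis w_edges : forall u v x y, adj u v -> adj x y ->
  [/\ u != x, u != y, v != x & v != y] -> w u x (+) w u y = w v x (+) w v y.

(** Telescopes [w_edges] twice: over [A] with an edge of [B] fixed, then over [B]. *)
Lemma order_connected A B a a' b b' : connected_in A -> connected_in B ->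
    [disjoint A & B] -> a \in A -> a' \in A -> b \in B -> b' \in B ->
  w a b (+) w a b' = w a' b (+) w a' b'.
Proof.
move=> cA cB dAB aA a'A bB b'B.
have neq := disjoint_neq dAB.
have stepA x y : x \in B -> y \in B -> adj x y ->
    w a x (+) w a y = w a' x (+) w a' y.
  move=> xB yB xy; pose f c := w c x (+) w c y.
  apply: (@connected_const _ f A) => // u v uA vA uv.
  by apply: w_edges => //; split; exact: neq.
pose g c := w a c (+) w a' c.
have : g b = g b'.
  apply: (@connected_const _ g B) => // x y xB yB xy.
  rewrite /g; move: (stepA _ _ xB yB xy).
  by move: (w a x) (w a y) (w a' x) (w a' y) => [] [] [] [].
by rewrite /g; move: (w a b) (w a b') (w a' b) (w a' b') => [] [] [] [].
Qed.

Lemma order_pairs A A' B B' a a' b b' :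
    [/\ connected_in A, connected_in A', connected_in B & connected_in B'] ->
    touch A A' -> touch B B' ->
    [/\ [disjoint A & B], [disjoint A & B'], [disjoint A' & B] &
      [disjoint A' & B']] ->
    [/\ a \in A, a' \in A', b \in B & b' \in B'] ->
  w a b (+) w a b' = w a' b (+) w a' b'.
Proof.
move=> [cA cA' cB cB'] tA tB [dAB dAB' dA'B dA'B'] [aA a'A bB b'B].
apply: (@order_connected (A :|: A') (B :|: B'));
  rewrite ?inE ?aA ?a'A ?bB ?b'B ?orbT //.
- by apply: connected_inU => //; rewrite tA.
- by apply: connected_inU => //; rewrite tB.
rewrite !disjoint_setUl ![[disjoint _ & B :|: B']]disjoint_sym !disjoint_setUl.
by rewrite !(disjoint_sym B) !(disjoint_sym B') dAB dAB' dA'B.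
Qed.

(** One equation for each of the three perfect matchings of K_4. In their sum each [w c (m j)]
    occurs twice, while each of the three pairs of legs occurs in both directions and contributes
    1. *)
Lemma no_K4 C (M : 'I_3 -> {set G}) : spider C M ->
  (forall i j, i != j -> touch (M i) (M j)) -> False.
Proof.
move=> [cC cM dCM tCM dM] tM.
have [[c cc] _] := cC.
have /choice[m mM] i : exists m, m \in M i by case: (cM i).
have E i j k : i != j -> i != k -> j != k ->
    w c (m j) (+) w c (m k) = w (m i) (m j) (+) w (m i) (m k).
  move=> ij ik jk.
  by apply: (@order_pairs C (M i) (M j) (M k) c (m i) (m j) (m k));
    [split| | |split|split]; auto.
pose i0 : 'I_3 := ord0; pose i1 : 'I_3 := lift i0 ord0.
pose i2 : 'I_3 := ord_max.
have e1 := E i0 i1 i2 isT isT isT; have e2 := E i1 i0 i2 isT isT isT.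
have e3 := E i2 i0 i1 isT isT isT; move: e1 e2 e3.
have neq i j : i != j -> m i != m j.
  by move=> /dM dij; exact: disjoint_neq dij _ _.
rewrite (w_anti (neq i0 i1 isT)) (w_anti (neq i0 i2 isT)).
rewrite (w_anti (neq i1 i2 isT)).
move: (w (m i0) (m i1)) (w (m i0) (m i2)) (w (m i1) (m i2)) (w c (m i0))
  (w c (m i1)) (w c (m i2)).
by do 6!case.
Qed.

(** One equation for each ordered pair of distinct legs. All terms involving [a] or [b] occur an
    even number of times; the three pairs of legs contribute 1 each. *)
Lemma no_K23 A B (L : 'I_3 -> {set G}) : spider A L -> spider B L ->
  [disjoint A & B] -> False.
Proof.
move=> [cA cL dA tA dL] [cB _ dB tB _] dAB.
have [[a aA] _] := cA; have [[b bB] _] := cB.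
have /choice[m mL] i : exists m, m \in L i by case: (cL i).
have E i j : i != j -> w a b (+) w a (m j) = w (m i) b (+) w (m i) (m j).
  move=> ij; apply: (@order_pairs A (L i) B (L j) a (m i) b (m j));
    [split| | |split|split]; auto.
  by rewrite disjoint_sym.
pose i0 : 'I_3 := ord0; pose i1 : 'I_3 := lift i0 ord0.
pose i2 : 'I_3 := ord_max.
have neq i j : i != j -> m i != m j.
  by move=> /dL dij; exact: disjoint_neq dij _ _.
have a01 := E i0 i1 isT; have a10 := E i1 i0 isT; have a02 := E i0 i2 isT.
have a20 := E i2 i0 isT; have a12 := E i1 i2 isT; have a21 := E i2 i1 isT.
move: a01 a10 a02 a20 a12 a21.
rewrite (w_anti (neq i0 i1 isT)) (w_anti (neq i0 i2 isT)).
rewrite (w_anti (neq i1 i2 isT)).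
move: (w (m i0) (m i1)) (w (m i0) (m i2)) (w (m i1) (m i2)) (w (m i0) b)
  (w (m i1) b) (w (m i2) b) (w a (m i0)) (w a (m i1)) (w a (m i2)) (w a b).
by do 10!case.
Qed.

Lemma nested_far k S T : nested k S -> connected_in T -> [disjoint T & S] ->
  exists2 x, x \in S & x \notin gball T k.
Proof.
elim: k S T => [|k IH] S T.
  move=> [[x xS] _] _ dTS; exists x => //=.
  by apply/negP => xT; have := disjoint_neq dTS xT xS; rewrite eqxx.
move=> [C [L [sp nL ->]]] cT dTS; have [cC cL dC tC dL] := sp.
have dTC : [disjoint T & C] by apply: disjointWr dTS; exact: subsetUl.
have dTL i : [disjoint T & L i].
  apply: disjointWr dTS; apply: subset_trans (subsetUr _ _); exact: bigcup_sup.
(* If [T] touched every leg, [T] and [C] would be the two centres of a K_{2,3}. *)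
have [/forallP tT|] := boolP [forall i, touch T (L i)].
  by case: (@no_K23 C T L) => //; rewrite disjoint_sym.
move=> /forallPn[i ntT].
have [||x xL xT] := IH (L i) (nbr T) (nL i); first exact: connected_nbr.
  by rewrite nbr_disjoint dTL.
exists x; last by rewrite /gball iterSr.
by apply/setUP; right; apply/bigcupP; exists i.
Qed.

Lemma gball1_disjoint x k T :
  x \notin gball T k -> [disjoint gball [set x] k & T].
Proof. by move=> xT; rewrite gball_disjointC disjoints1. Qed.

(** Some [x] in [S'] is at distance more than [k] from [S]; its ball of radius [k] then serves as
    the connected set from which [S] has a distant point. *)
Lemma nested_pair_far k S S' : nested k S -> nested k S' -> [disjoint S & S'] ->
  exists x y, y \notin gball [set x] (k + k).
Proof.
move=> nS nS' dS.
have [x xS' xS] := nested_far nS' (nested_connected nS) dS.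
have [y yS yx] := nested_far nS (connected_gball k (connected_in1 x))
  (gball1_disjoint xS).
by exists x, y; rewrite -gballD.
Qed.

(** * Graphs of diameter at most [k + k.+1] *)

Section Dense.
Variable k : nat.
Hypothesis dense : forall x y, y \in gball [set x] (k + k.+1).

(** Otherwise the ball of radius [k.+1] would miss [L], and [nested_far] would give a point of [L]
    at distance more than [k + k.+1] from [x]. *)
Let touch_nested x L : nested k L -> [disjoint gball [set x] k & L] ->
  touch (gball [set x] k) L.
Proof.
move=> nL dL; apply: contraT => ntL.
have dN : [disjoint gball [set x] k.+1 & L].
  by rewrite [gball _ _]/(nbr _) nbr_disjoint dL ntL.
have [y _] := nested_far nL (connected_gball k.+1 (connected_in1 x)) dN.
by rewrite gballD dense.
Qed.

(** Some [x] in [M i] is at distance more than [k] from [C] and the other legs, so its ball can be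
    added to [M i]; by [touch_nested] it touches these legs. Asking only that legs contain nested
    sets allows a second application. *)
Let grow C (M : 'I_3 -> {set G}) i :
    spider C M -> (forall j, exists2 L, nested k L & L \subset M j) ->
  exists M' : 'I_3 -> {set G}, [/\ spider C M', forall j, M j \subset M' j &
    forall j, j != i -> touch (M' i) (M' j)].
Proof.
move=> [cC cM dC tC dM] nM.
pose T := C :|: \bigcup_(j | j != i) M j.
have cT : connected_in T by apply: connected_star.
have [L nL sL] := nM i.
have dTM : [disjoint T & M i].
  rewrite -setI_eq0 setIUl; apply/eqP/setP => z; rewrite !inE.
  apply/negP => /orP[/andP[zC zM]|/andP[/bigcupP[j ji zj] zM]].
    by have := disjoint_neq (dC i) zC zM; rewrite eqxx.
  by have := disjoint_neq (dM _ _ ji) zj zM; rewrite eqxx.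
have [x xL xT] := nested_far nL cT (disjointWr sL dTM).
have dX := gball1_disjoint xT; set X := gball _ _ in dX.
have dXM j : j != i -> [disjoint X & M j].
  move=> ji; apply: disjointWr dX; apply: subset_trans (subsetUr _ _).
  exact: bigcup_sup.
pose M' j := if j == i then M i :|: X else M j.
have sM j : M j \subset M' j.
  by rewrite /M'; case: eqP => [->|_]; rewrite ?subsetUl.
have M'i : M' i = M i :|: X by rewrite /M' eqxx.
have M'j j : j != i -> M' j = M j by rewrite /M' => /negPf->.
have dM'i j : j != i -> [disjoint M' i & M j].
  by move=> ji; rewrite M'i disjoint_setUl dXM // dM // eq_sym.
exists M'; split; [split| |]; last 2 first.
- exact: sM.
- move=> j ji; have [L' nL' sL'] := nM j; rewrite (M'j j ji) M'i.
  apply: (touchS (subsetUr _ _) sL'); apply: touch_nested => //.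
  by apply: (disjointWr sL'); exact: dXM.
- exact: cC.
- move=> j; rewrite /M'; case: eqP => // _; apply: connected_inU => //.
    exact: connected_gball (connected_in1 x).
  apply/orP; right; apply/pred0Pn; exists x => /=.
  by rewrite (subsetP sL) // (subsetP (sub_gball _ _)) // set11.
- move=> j; rewrite /M'; case: eqP => // _; rewrite disjoint_sym disjoint_setUl.
  rewrite disjoint_sym dC /=.
  by apply: disjointWr dX; exact: subsetUl.
- by move=> j; apply: touchS (tC j).
- move=> j l jl; have [ji|ji] := eqVneq j i.
    by rewrite ji (M'j l) ?dM'i // -?ji // eq_sym.
  have [li|li] := eqVneq l i; first by rewrite li (M'j j) // disjoint_sym dM'i.
  by rewrite !M'j // dM.
Qed.

(** Growing two legs suffices for K_4, since two distinct indices of ['I_3] always include [ord0] or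
    [ord_max]. *)
Lemma dense_no_spider C (L : 'I_3 -> {set G}) :
  spider C L -> (forall i, nested k (L i)) -> False.
Proof.
move=> sp nL.
have [|M [spM sLM tM]] := @grow _ _ ord0 sp; first by move=> j; exists (L j).
have [|N [spN sMN tN]] := @grow _ _ ord_max spM.
  by move=> j; exists (L j).
apply: (no_K4 spN) => i j ij.
have t2 l : l != ord_max -> touch (N ord_max) (N l) by exact: tN.
have t0 l : l != ord0 -> touch (N ord0) (N l).
  by move=> l0; apply: touchS (sMN _) (sMN _) (tM _ l0).
have [i0|i0] := eqVneq i ord0; first by rewrite i0 t0 // -i0 eq_sym.
have [j0|j0] := eqVneq j ord0; first by rewrite j0 touchC t0.
have [i2|i2] := eqVneq i ord_max; first by rewrite i2 t2 // -i2 eq_sym.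
have [j2|j2] := eqVneq j ord_max; first by rewrite j2 touchC t2.
by case/negP: ij; case: i j i0 j0 i2 j2 => [[|[|[|i]]] ?] [[|[|[|j]]] ?].
Qed.

Lemma dense_no_quadruple (S : 'I_4 -> {set G}) : (forall i, nested k (S i)) ->
  (forall i j, i != j -> [disjoint S i & S j]) -> False.
Proof.
move=> nS dS.
have cS i := nested_connected (nS i).
pose ok (p : 'I_4 * {set G}) :=
  `[< connected_in p.2 >] && [disjoint p.2 & S p.1].
have ok0 : ok (ord0, S ord_max).
  by rewrite /ok /= dS // andbT; apply/asboolP.
have [[i T]] := arg_maxnP (fun p : 'I_4 * {set G} => #|p.2|) ok0.
rewrite /ok /= => /andP[/asboolP cT dT] Tmax {ok0}.
have Tmax' j T' : connected_in T' -> [disjoint T' & S j] -> #|T'| <= #|T|.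
  by move=> cT' dT'; apply: (Tmax (j, T')); rewrite dT' andbT; apply/asboolP.
(* Otherwise [nbr T] also misses [S i], so [T] is closed under adjacency by maximality, and [dense]
   makes it the whole graph. *)
have tT : touch T (S i).
  apply: contraT => ntT.
  have nT : T = nbr T.
    apply/eqP; rewrite eqEcard sub_nbr (Tmax' i) //; first exact: connected_nbr.
    by rewrite nbr_disjoint dT.
  have bT n : gball T n = T.
    by elim: n => // n IH; rewrite /gball iterS -/(gball T n) IH -nT.
  have [[[x xT] _] [[y yS] _]] := (cT, cS i).
  have yT : y \in T.
    rewrite -(bT (k + k.+1)).
    have : [disjoint gball [set x] (k + k.+1) & [set y]] = false.
      by apply/negbTE/pred0Pn; exists y; rewrite /= dense set11.
    apply: contraFT => yT; rewrite gball_disjointC.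
    apply: disjointWl (_ : _ \subset T) _.
      by rewrite sub1set.
    by rewrite -gball_disjointC disjoint_sym disjoints1.
  by have := disjoint_neq dT yT yS; rewrite eqxx.
(* If [T] missed [S j], the larger set [T :|: S i] would miss it too. Otherwise [T :|: S j] is
   connected and misses [S i], hence equals [T]. *)
have sST j : j != i -> S j \subset T.
  move=> ji; have [dTj|ndTj] := boolP [disjoint T & S j].
    have cTi : connected_in (T :|: S i) by apply: connected_inU; rewrite ?tT.
    have dTi : [disjoint T :|: S i & S j].
      by rewrite disjoint_setUl dTj dS // eq_sym.
    have := Tmax' j _ cTi dTi; rewrite leqNgt => /negP[]; apply: proper_card.
    rewrite properE subsetUl; apply/subsetPn; have [[y yS] _] := cS i.
    exists y; first by rewrite inE yS orbT.
    by apply/negP => yT; have := disjoint_neq dT yT yS; rewrite eqxx.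
  have cTj : connected_in (T :|: S j).
    by apply: connected_inU; rewrite ?ndTj ?orbT.
  have dTj : [disjoint T :|: S j & S i] by rewrite disjoint_setUl dT dS.
  have : T == T :|: S j by rewrite eqEcard subsetUl (Tmax' i).
  by move/eqP->; exact: subsetUr.
have [x xS xT] := nested_far (nS i) cT dT.
have dX := gball1_disjoint xT; set X := gball _ _ in dX.
have dXS j : j != i -> [disjoint X & S j].
  by move=> ji; apply: disjointWr dX; exact: sST.
have ni (j : 'I_3) : lift i j != i by rewrite eq_sym neq_lift.
(* The missed part and the ball form the centre; [lift i] enumerates the other three parts, which
   are the legs. *)
apply: (@dense_no_spider (S i :|: X) (fun j : 'I_3 => S (lift i j))) => //.
split=> //.
- apply: connected_inU => //; first exact: connected_gball (connected_in1 x).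
  apply/orP; right; apply/pred0Pn; exists x => /=.
  by rewrite xS (subsetP (sub_gball _ _)) // set11.
- by move=> j; rewrite disjoint_setUl dXS // dS // eq_sym.
- move=> j; apply: touchS (subsetUr _ _) (subxx _) _.
  by apply: touch_nested => //; exact: dXS.
- by move=> j l jl; apply: dS; rewrite (inj_eq lift_inj).
Qed.

End Dense.

End Graphs.

(** * Nested sets from minors in the families A and B *)

Section Models.
Variable G : sgraph.

Definition model (H : sgraph) (phi : H -> {set G}) :=
  [/\ forall x, connected_in (phi x),
      forall x y, x != y -> [disjoint phi x & phi y]
    & forall x y, adj x y -> touch (phi x) (phi y)].

Lemma minor_model H : minor H G -> exists phi : H -> {set G}, model phi.
Proof.
move=> [phi [c d e]]; exists phi; split=> // [x y /d xy|x y /e[u [v uv]]].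
  by rewrite -setI_eq0 xy.
by apply/touchP; exists u, v.
Qed.

Lemma disjoint_bigcups (I J : finType) (f : I -> {set G}) (g : J -> {set G}) :
  (forall i j, [disjoint f i & g j]) ->
  [disjoint \bigcup_i f i & \bigcup_j g j].
Proof.
move=> dfg; apply/pred0P => z; apply/negbTE/andP => -[].
move=> /bigcupP[i _ zi] /bigcupP[j _ zj].
by have := disjoint_neq (dfg i j) zi zj; rewrite eqxx.
Qed.

Lemma model_summand i (F : 'I_i -> sgraph) (phi : dunion F -> {set G}) k :
  model phi -> model (fun y : F k => phi (Tagged F y)).
Proof.
move=> [c d e]; split=> // [x y xy|x y xy].
  by apply: d; rewrite eq_Tagged.
by apply: e; rewrite /adj /= /dunion_adj eqxx tagged_asE.
Qed.

Lemma summands_disjoint i (F : 'I_i -> sgraph) (phi : dunion F -> {set G}) k l :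
  model phi -> k != l ->
  [disjoint \bigcup_(y : F k) phi (Tagged F y) &
    \bigcup_(y : F l) phi (Tagged F y)].
Proof.
move=> [_ d _] kl; apply: disjoint_bigcups => x y; apply: d.
by apply: contraNneq kl => /(congr1 tag) /= ->.
Qed.

Lemma model_dunion i (F : 'I_i -> sgraph) (a : forall k, F k)
    (phi : join_graph a -> {set G}) :
  model phi -> model (fun y : dunion F => phi (Some y)).
Proof.
move=> [c d e]; split=> // [x y xy|x y xy]; last exact: e.
by apply: d; apply: contraNneq xy => -[->].
Qed.

(** [famB] is empty at even indices and descends by two, [nested] by one; the successor appears
    because the star of [famB 1] is already one level above K_1. *)
Lemma nested_famB D (H : sgraph) (phi : H -> {set G}) : famB D H -> model phi ->
  odd D /\ nested D./2.+1 (\bigcup_x phi x).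
Proof.
elim/ltn_ind: D H phi => -[|[|D]] IH H phi //.
- move=> HE; move: phi; rewrite {}HE => phi [c d e]; split=> //.
  exists (phi None), (fun i => phi (Some i)); split=> //; first split=> //.
  + by move=> i; apply: d.
  + by move=> i; apply: e.
  + by move=> i j ij; apply: d; apply: contraNneq ij => -[->].
  + by move=> i; exact: c.
  apply/setP => z; rewrite inE; apply/bigcupP/orP => [[[i|] _ zi]|].
  + by right; apply/bigcupP; exists i.
  + by left.
  by case=> [z0|/bigcupP[i _ zi]]; [exists None|exists (Some i)].
rewrite [famB _]/=; case: ifP => // oD [F [a [fF HE]]].
move: phi; rewrite {}HE => phi mphi.
have mdu := model_dunion mphi.
have nF k : nested D./2.+1 (\bigcup_(y : F k) phi (Some (Tagged F y))).
  exact: (IH D _ (F k) _ (fF k) (model_summand k mdu)).2.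
have [c d e] := mphi.
split; first by [].
exists (phi None), (fun k => \bigcup_(y : F k) phi (Some (Tagged F y))).
split=> //.
  split=> //.
  + by move=> k; exact: nested_connected (nF k).
  + move=> k; apply/pred0P => z; apply/negbTE/andP => -[z0 /bigcupP[y _ zy]].
    have dy : [disjoint phi None & phi (Some (Tagged F y))] by apply: d.
    by have := disjoint_neq dy z0 zy; rewrite eqxx.
  + move=> k; have := e None (Some (Tagged F (a k))).
    rewrite /adj /= => /(_ (eqxx _)); apply: touchS => //.
    exact: (bigcup_sup (a k)).
  by move=> k l kl; exact: (summands_disjoint mdu).
apply/setP => z; rewrite inE; apply/bigcupP/orP => [[[[k y]|] _ zi]|].
- by right; apply/bigcupP; exists k => //; apply/bigcupP; exists y.
- by left.
case=> [z0|/bigcupP[k _ /bigcupP[y _ zy]]]; first by exists None.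
by exists (Some (Tagged F y)).
Qed.

(** Containment in [A] keeps the families of distinct summands disjoint when they are merged. *)
Definition nested_family k n (A : {set G}) := exists S : 'I_n -> {set G},
  [/\ forall i, nested k (S i), forall i j, i != j -> [disjoint S i & S j] &
      forall i, S i \subset A].

Lemma nested_familyD k m n A B : nested_family k m A -> nested_family k n B ->
  [disjoint A & B] -> nested_family k (m + n) (A :|: B).
Proof.
move=> [S [nS dS SA]] [S' [nS' dS' S'B]] dAB.
exists (fun i => match split i with inl j => S j | inr j => S' j end); split.
- by move=> i; case: split.
- move=> i j; rewrite -(inj_eq (can_inj (@splitK _ _))).
  case: (split i) (split j) => [i'|i'] [j'|j'] ij.
  + by apply: dS; apply: contraNneq ij => ->.
  + exact: disjointW (SA i') (S'B j') dAB.
  + by rewrite disjoint_sym; exact: disjointW (SA j') (S'B i') dAB.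
  + by apply: dS'; apply: contraNneq ij => ->.
- move=> i; case: split => j.
    by apply: subset_trans (SA j) _; exact: subsetUl.
  by apply: subset_trans (S'B j) _; exact: subsetUr.
Qed.

Lemma nested_copies k n (F : 'I_2 -> sgraph) (phi : dunion F -> {set G}) :
    model phi ->
    (forall i, nested_family k n (\bigcup_(y : F i) phi (Tagged F y))) ->
  nested_family k (n + n) (\bigcup_x phi x).
Proof.
move=> mphi nF.
have [S [nS dS SA]] := nested_familyD (nF ord0) (nF ord_max)
  (summands_disjoint mphi (isT : ord0 != ord_max :> 'I_2)).
exists S; split=> // i; apply: subset_trans (SA i) _.
by apply/subUsetP; split; apply/bigcupsP => y _; exact: bigcup_sup.
Qed.

(** For odd [D], each of the two copies is itself a pair of the same level, whence 4. For even
    positive [D], each copy is a single member of [famB], whence 2. *)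
Lemma nested_famA D (H : sgraph) (phi : H -> {set G}) : famA D H -> model phi ->
  nested_family D./2 (if odd D then 4 else 2) (\bigcup_x phi x).
Proof.
elim: D H phi => [|D IH] H phi.
  move=> HE; move: phi; rewrite {}HE => phi [c d e].
  exists phi; split=> // i; exact: (bigcup_sup i).
rewrite [famA _]/=; case: ifP => oD [F [fF HE]]; move: phi;
  rewrite {}HE => phi mphi.
  have [eD Dh] : ~~ odd D /\ D.+1./2 = D./2 by move: oD; split; lia.
  rewrite [odd _]/= oD Dh; apply: (@nested_copies _ 2) => // i.
  by have := IH _ _ (fF i) (model_summand i mphi); rewrite (negPf eD).
have Dh : D.+1./2 = D./2.+1 by move: oD; lia.
rewrite [odd _]/= oD Dh; apply: (@nested_copies _ 1) => // i.
have [_ nF] := nested_famB (fF i) (model_summand i mphi).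
exists (fun=> \bigcup_(y : F i) phi (Tagged F y)); split=> // j l.
by rewrite !ord1 eqxx.
Qed.
End Models.

(** * The bound on the diameter *)

Local Open Scope classical_set_scope.
Local Open Scope ring_scope.

(** A walk of length at most [n] from [x] stays in the ball, so every walk to [y] is longer; without
    any walk the infimum is infinite. *)
Lemma diameter_ge (R : realType) (G : sgraph) n (x y : G) :
  y \notin gball [set x]%SET n -> ((n.+1%:R)%:E <= diameter R G)%E.
Proof.
move=> yx; apply: (@le_trans _ _ (dist R x y)); last first.
  by apply: ereal_sup_ubound; exists x, y.
apply: le_ereal_inf_tmp => _ [p [px py] <-].
rewrite lee_fin ler_nat ltnNge; apply: contra yx => pn.
rewrite -py -(subnK pn) -gballD.
by apply: (subsetP (sub_gball _ _)); rewrite path_gball.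
Qed.

Theorem theorem3 (R : realType) (D : nat) (G : sgraph)
    (hG : outerplanar R G)
    (hminor : exists2 H : sgraph, famA D H \/ famB D H & minor H G) :
  ((D.+1%:R)%:E <= diameter R G)%E.
Proof.
have [d outer] := hG; have [w [w_anti w_edges]] := outer_order outer.
suff [x [y xy]] : exists x y : G, y \notin gball [set x]%SET D.
  exact: diameter_ge xy.
apply: contrapT => far.
have dense (x y : G) : y \in gball [set x]%SET D.
  by apply: contrapT => /negP xy; apply: far; exists x, y.
have [H [fA|fB] /minor_model[phi mphi]] := hminor.
  have [S [nS dS _]] := nested_famA fA mphi.
  case: ifP (S) nS dS => oD {}S nS dS.
    apply: (dense_no_quadruple w_anti w_edges _ nS dS) => x y.
    by have -> : (D./2 + D./2.+1 = D)%N by [move: oD; lia]; exact: dense.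
  have [x [y]] := nested_pair_far w_anti w_edges (nS ord0) (nS ord_max)
    (dS ord0 ord_max isT).
  have -> : (D./2 + D./2 = D)%N by move: oD; lia.
  by rewrite dense.
(* Level [D./2.+1] unfolds to a spider with legs of level [D./2], which matches the distance [D]
   since [D] is odd. *)
have [oD [C [L [sp nL _]]]] := nested_famB fB mphi.
apply: (dense_no_spider w_anti w_edges _ sp nL) => x y.
by have -> : (D./2 + D./2.+1 = D)%N by [move: oD; lia]; exact: dense.
Qed.
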